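(* The set consisting of the three clauses $$\top\approx\bot\Rightarrow\emptyset,\qquad x\vee y\approx\top\Rightarrow x\approx\top,\ y\approx\top,\qquad \neg x\preccurlyeq x,\ x\wedge\neg y\preccurlyeq\neg x\vee y\ \Rightarrow\ \neg y\preccurlyeq y$$ is a basis for the admissible clauses of Kleene algebras.
   Context: A Kleene algebra is an algebra $(A,\wedge,\vee,\neg,\bot,\top)$ such that $(A,\wedge,\vee,\bot,\top)$ is a bounded distributive lattice, $\neg\neg a=a$, $\neg(a\wedge b)=\neg a\vee\neg b$, and $a\wedge\neg a\leq b\vee\neg b$ for all $a,b\in A$. $\varphi\preccurlyeq\psi$ abbreviates the identity $\varphi\wedge\psi\approx\varphi$. A clause $\Sigma\Rightarrow\Delta$ (with $\Sigma,\Delta$ finite, possibly empty, sets of identities) is satisfied by an algebra if every assignment of the variables making all identities in $\Sigma$ true makes at least one identity in $\Delta$ true (so $\Sigma\Rightarrow\emptyset$ means that no assignment makes all of $\Sigma$ true). A universal class is the class of all algebras of the language satisfying some set of clauses; $\mathbb{U}(\mathcal{K})$ is the smallest universal class containing $\mathcal{K}$. For a quasivariety $\mathcal{Q}$, $\mathbf{F}_{\mathcal{Q}}$ is its free algebra on countably infinitely many generators. A set $\Lambda$ of clauses is a basis for the admissible clauses of $\mathcal{Q}$ if $\mathbb{U}(\mathbf{F}_{\mathcal{Q}})$ is axiomatized by $\Lambda$ relative to $\mathcal{Q}$, i.e. for every algebra $\mathbf{A}$: $\mathbf{A}\in\mathbb{U}(\mathbf{F}_{\mathcal{Q}})$ iff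 $\mathbf{A}\in\mathcal{Q}$ and $\mathbf{A}$ satisfies all clauses in $\Lambda$. *)

(* Defs.v *)
From HB Require Import structures.
From mathcomp Require Import all_boot finmap.
From mathcomp Require Import boolp classical_sets.

Set Implicit Arguments.
Unset Strict Implicit.
Unset Printing Implicit Defensive.

Inductive term : Type :=
  | Var of nat
  | Bot
  | Top
  | Neg of term
  | Meet of term & term
  | Join of term & term.

Fixpoint term_code (t : term) : GenTree.tree nat :=
  match t with
  | Var n => GenTree.Leaf n
  | Bot => GenTree.Node 0 [::]
  | Top => GenTree.Node 1 [::]
  | Neg s => GenTree.Node 2 [:: term_code s]
  | Meet s u => GenTree.Node 3 [:: term_code s; term_code u]
  | Join s u => GenTree.Node 4 [:: term_code s; term_code u]
  end.

Fixpoint term_decode (c : GenTree.tree nat) : option term :=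
  match c with
  | GenTree.Leaf n => Some (Var n)
  | GenTree.Node 0 [::] => Some Bot
  | GenTree.Node 1 [::] => Some Top
  | GenTree.Node 2 [:: c1] => omap Neg (term_decode c1)
  | GenTree.Node 3 [:: c1; c2] =>
      obind (fun s => omap (Meet s) (term_decode c2)) (term_decode c1)
  | GenTree.Node 4 [:: c1; c2] =>
      obind (fun s => omap (Join s) (term_decode c2)) (term_decode c1)
  | _ => None
  end.

Lemma term_codeK : pcancel term_code term_decode.
Proof. by elim=> //= [s ->|s -> u ->|s -> u ->]. Qed.

HB.instance Definition _ := Countable.copy term (pcan_type term_codeK).

Definition identity : Type := (term * term)%type.

Definition clause : Type := ({fset identity} * {fset identity})%type.

Declare Scope clause_scope.
Delimit Scope clause_scope with clause.
Notation "s ≈ t" := ((s, t) : identity) (at level 70) : clause_scope.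
Notation "s ≼ t" := ((Meet s t, s) : identity) (at level 70) : clause_scope.
Notation "S ⇒ D" := ((S, D) : clause) (at level 90) : clause_scope.

(* An arbitrary algebra of the language; no identities are assumed. *)
Record algebra : Type := Algebra {
  carrier :> Type;
  abot : carrier;
  atop : carrier;
  aneg : carrier -> carrier;
  ameet : carrier -> carrier -> carrier;
  ajoin : carrier -> carrier -> carrier }.

Fixpoint eval (A : algebra) (v : nat -> A) (t : term) : A :=
  match t with
  | Var n => v n
  | Bot => abot A
  | Top => atop A
  | Neg s => aneg (eval v s)
  | Meet s u => ameet (eval v s) (eval v u)
  | Join s u => ajoin (eval v s) (eval v u)
  end.

Definition holds (A : algebra) (v : nat -> A) (e : identity) : Prop :=
  eval v e.1 = eval v e.2.

Definition satisfies (A : algebra) (c : clause) : Prop :=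
  forall v : nat -> A,
    (forall e, e \in c.1 -> holds v e) -> exists2 e, e \in c.2 & holds v e.

(* Not [set algebra]: the universe of [set] would then have to lie strictly
   above that of carriers, so that no carrier could be of the form [set X]. *)
Definition algebra_class : Type := algebra -> Prop.

Definition universal_class (U : algebra_class) : Prop :=
  exists L : set clause,
    forall A, U A <-> (forall c, L c -> satisfies A c).

(* The intersection of all universal classes containing K is itself one:
   it is axiomatized by the clauses satisfied throughout K. *)
Definition univ_closure (K : algebra_class) : algebra_class :=
  fun A => forall U, universal_class U -> (forall B, K B -> U B) -> U A.

Local Open Scope quotient_scope.

Section FreeAlgebra.
Variable Q : algebra_class.

Definition eq_in (s t : term) : bool :=
  `[< forall A, Q A -> forall v : nat -> A, holds v (s, t) >].

Lemma eq_in_refl : reflexive eq_in.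
Proof. by move=> s; apply/asboolP. Qed.

Lemma eq_in_sym : symmetric eq_in.
Proof. by move=> s t; apply/asboolP/asboolP=> st A QA v; rewrite /holds st. Qed.

Lemma eq_in_trans : transitive eq_in.
Proof.
move=> t s u /asboolP st /asboolP tu; apply/asboolP=> A QA v.
by rewrite /holds (st A QA v) (tu A QA v).
Qed.

Canonical eq_in_equiv := EquivRel eq_in eq_in_refl eq_in_sym eq_in_trans.

(* Terms over the countably many variables, modulo the identities valid
   in Q. For a quasivariety Q this is the free algebra of Q on the classes of
   the variables. *)
Definition free_carrier := {eq_quot eq_in}.

Definition free_algebra : algebra := {|
  carrier := free_carrier;
  abot := \pi_free_carrier Bot;
  atop := \pi_free_carrier Top;
  aneg := fun a => \pi_free_carrier (Neg (repr a));
  ameet := fun a b => \pi_free_carrier (Meet (repr a) (repr b));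
  ajoin := fun a b => \pi_free_carrier (Join (repr a) (repr b)) |}.

End FreeAlgebra.

Definition admissible_basis (Q : algebra_class) (L : set clause) : Prop :=
  forall A : algebra,
    univ_closure (fun B => B = free_algebra Q) A <->
    Q A /\ (forall c, L c -> satisfies A c).

Record bounded_distributive_lattice (A : algebra) : Prop := {
  meetA : associative (@ameet A);
  meetC : commutative (@ameet A);
  joinA : associative (@ajoin A);
  joinC : commutative (@ajoin A);
  meetKj : forall a b : A, ameet a (ajoin a b) = a;
  joinKm : forall a b : A, ajoin a (ameet a b) = a;
  meet_joinl : left_distributive (@ameet A) (@ajoin A);
  join0a : left_id (abot A) (@ajoin A);
  meet1a : left_id (atop A) (@ameet A) }.

Definition ale (A : algebra) (a b : A) : Prop := ameet a b = a.

Record kleene_algebra (A : algebra) : Prop := {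
  kleene_lattice : bounded_distributive_lattice A;
  negK : involutive (@aneg A);
  neg_meet : forall a b : A, aneg (ameet a b) = ajoin (aneg a) (aneg b);
  kleene_le : forall a b : A, ale (ameet a (aneg a)) (ajoin b (aneg b)) }.

(* Main.v *)
(* The three-element chain K3 generates the variety of Kleene algebras, so an
   identity holds in the free algebra F iff it holds in K3. Order K3 by
   information, with the middle element below the two classical ones; terms are
   monotone for this order, which gives the three clauses in F. Conversely, let
   A be a Kleene algebra satisfying them. The first two make the preimage {top}
   of 1 define a homomorphism from A to K3 that is below all others, and the
   third makes every homomorphism lie below a classical one. Given finitely many
   pairs f <= g with g classical, a decision list over K3-valued variables whose
   undecided value is the least homomorphism sends assignments to homomorphisms
   monotonically and reaches every f. For each element a the value at a is then
   given by a term, so an assignment in A refuting a clause can be moved to F. *)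
Require Import Defs.
From mathcomp Require Import all_boot finmap.
From mathcomp Require Import boolp classical_sets.

Set Implicit Arguments.
Unset Strict Implicit.
Unset Printing Implicit Defensive.

Local Open Scope fset_scope.
Local Open Scope classical_set_scope.
Local Open Scope clause_scope.

(** * Homomorphisms, the chain [K3] and its information order *)

Record hom (A B : algebra) (f : A -> B) : Prop := {
  hom_bot : f (abot A) = abot B;
  hom_top : f (atop A) = atop B;
  hom_neg : forall a, f (aneg a) = aneg (f a);
  hom_meet : forall a b, f (ameet a b) = ameet (f a) (f b);
  hom_join : forall a b, f (ajoin a b) = ajoin (f a) (f b) }.

Lemma hom_eval (A B : algebra) (f : A -> B) (v : nat -> A) (t : term) :
  hom f -> f (eval v t) = eval (f \o v) t.
Proof.
case=> fb ft fn fm fj.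
by elim: t => //= [s <-|s <- u <-|s <- u <-].
Qed.

(* [None] is the middle element of the chain [Some false < None < Some true]. *)
Definition K3 : algebra := {|
  carrier := option bool;
  abot := Some false;
  atop := Some true;
  aneg := omap negb;
  ameet := fun a b => match a, b with
    | Some false, _ | _, Some false => Some false
    | Some true, c | c, Some true => c
    | None, None => None
    end;
  ajoin := fun a b => match a, b with
    | Some true, _ | _, Some true => Some true
    | Some false, c | c, Some false => c
    | None, None => None
    end |}.

Lemma K3_kleene : kleene_algebra K3.
Proof.
split=> [|[[]|]|[[]|] [[]|]|[[]|] [[]|]] //.
by split; do ?[case=> [[]|]].
Qed.

Definition refines (a b : option bool) : bool := (a == None) || (a == b).

Lemma refines_some (a b : option bool) (c : bool) :
  refines a b -> a = Some c -> b = Some c.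
Proof. by rewrite /refines => /orP[/eqP->|/eqP->]. Qed.

Lemma eval_refines (p q : nat -> K3) (t : term) :
  (forall n, refines (p n) (q n)) -> refines (eval p t) (eval q t).
Proof.
move=> pq; elim: t => [n||| s|s + u|s + u] //=.
- by case: (eval p s) (eval q s) => [[]|] [[]|].
- by case: (eval p s) (eval q s) (eval p u) (eval q u)
    => [[]|] [[]|] [[]|] [[]|].
- by case: (eval p s) (eval q s) (eval p u) (eval q u)
    => [[]|] [[]|] [[]|] [[]|].
Qed.

Lemma eval_classical (p : nat -> K3) (t : term) :
  (forall n, isSome (p n)) -> isSome (eval p t).
Proof.
move=> pS; elim: t => [n||| s|s + u|s + u] /=; rewrite ?pS //.
- by case: (eval p s).
- by case: (eval p s) (eval p u) => [[]|] [[]|].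
- by case: (eval p s) (eval p u) => [[]|] [[]|].
Qed.

(** * Filters, ideals and the prime filter theorem *)

Definition lattice_filter (A : algebra) (P : set A) : Prop :=
  P (atop A) /\ forall a b, P (ameet a b) <-> P a /\ P b.

Definition lattice_ideal (A : algebra) (J : set A) : Prop :=
  J (abot A) /\ forall a b, J (ajoin a b) <-> J a /\ J b.

Record prime_filter (A : algebra) (P : set A) : Prop := {
  prime_filter_filter : lattice_filter P;
  prime_filter_bot : ~ P (abot A);
  prime_filter_join : forall a b, P (ajoin a b) <-> P a \/ P b }.

Section Lattice.
Variables (A : algebra) (bdlA : bounded_distributive_lattice A).

Lemma ale_refl (a : A) : ale a a.
Proof. by have := meetKj bdlA a (ameet a a); rewrite (joinKm bdlA). Qed.

Lemma ale_trans (b a c : A) : ale a b -> ale b c -> ale a c.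
Proof. by rewrite /ale => ab bc; rewrite -{1}ab -(meetA bdlA) bc. Qed.

Lemma ale_anti (a b : A) : ale a b -> ale b a -> a = b.
Proof. by rewrite /ale => ab ba; rewrite -ab (meetC bdlA) ba. Qed.

Lemma ale_meetl (a b : A) : ale (ameet a b) a.
Proof. by rewrite /ale (meetC bdlA) (meetA bdlA) ale_refl. Qed.

Lemma ale_meetr (a b : A) : ale (ameet a b) b.
Proof. by rewrite (meetC bdlA); apply: ale_meetl. Qed.

Lemma ale_meet (a b c : A) : ale c a -> ale c b -> ale c (ameet a b).
Proof. by rewrite /ale => ca cb; rewrite (meetA bdlA) ca. Qed.

Lemma ale_joinl (a b : A) : ale a (ajoin a b).
Proof. exact: (meetKj bdlA). Qed.

Lemma ale_joinr (a b : A) : ale b (ajoin a b).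
Proof. by rewrite (joinC bdlA); apply: ale_joinl. Qed.

Lemma ale_join (a b c : A) : ale a c -> ale b c -> ale (ajoin a b) c.
Proof. by rewrite /ale => ac bc; rewrite (meet_joinl bdlA) ac bc. Qed.

Lemma ale_bot (a : A) : ale (abot A) a.
Proof. by rewrite -(join0a bdlA a); apply: ale_joinl. Qed.

Lemma ale_top (a : A) : ale a (atop A).
Proof. by rewrite -{1}(meet1a bdlA a); apply: ale_meetl. Qed.

Lemma filter_le (P : set A) (a b : A) : lattice_filter P -> ale a b -> P a -> P b.
Proof. by case=> _ PM <- /PM[]. Qed.

Lemma filterP (P : set A) : P (atop A) ->
  (forall a b, ale a b -> P a -> P b) ->
  (forall a b, P a -> P b -> P (ameet a b)) -> lattice_filter P.
Proof.
move=> P1 Pup PM; split=> // a b; split=> [Pab|[] //]; last exact: PM.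
by split; apply: Pup Pab; [apply: ale_meetl|apply: ale_meetr].
Qed.

Lemma ideal_le (J : set A) (a b : A) : lattice_ideal J -> ale a b -> J b -> J a.
Proof.
move=> [_ JJ] ab.
by rewrite -(joinKm bdlA b a) (meetC bdlA) ab; case/JJ.
Qed.

(** Zorn's lemma yields a maximal filter above [G] avoiding [J]; distributivity makes it prime. *)
Lemma prime_filter_exists (G J : set A) :
  lattice_filter G -> lattice_ideal J -> (forall a, G a -> ~ J a) ->
  exists P, [/\ prime_filter P, G `<=` P & forall a, P a -> ~ J a].
Proof.
move=> filG idJ GJ.
(* Goodness concerns the union of [G] and [X], so that the union of the empty chain is good. *)
pose good X := lattice_filter (G `|` X) /\ forall a, (G `|` X) a -> ~ J a.
have [F Fgood Ftot|X [[filP PJ] Xmax]] := @Zorn_bigcup A good.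
  split; last first.
    move=> a [/GJ //|[X FX Xa]]; apply: (Fgood X FX).2; by right.
  apply: filterP.
  - by left; case: filG.
  - move=> a b ab [Ga|[X FX Xa]]; first by left; apply: filter_le Ga.
    have [Gb|Xb] : (G `|` X) b.
      by apply: (filter_le (Fgood X FX).1 ab); right.
    + by left.
    + by right; exists X.
  - suff main X a b : F X -> (G `|` X) a -> (G `|` X) b ->
        (G `|` \bigcup_(Y in F) Y) (ameet a b).
      move=> a b [Ga|[X FX Xa]] [Gb|[Y FY Yb]].
      + by left; apply/(filG.2 a b).
      + by apply: (main Y) => //; [left|right].
      + by apply: (main X) => //; [right|left].
      + have [XY|YX] := Ftot X Y FX FY.
          by apply: (main Y) => //; right=> //; apply: XY.
        by apply: (main X) => //; right=> //; apply: YX.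
    move=> FX Xa Xb.
    have [Gab|Xab] : (G `|` X) (ameet a b) by apply/((Fgood X FX).1.2 a b).
    + by left.
    + by right; exists X.
set P := G `|` X in filP PJ.
have ext c : ~ P c -> exists2 q, P q & J (ameet q c).
  move=> Pc; apply: contrapT => noq.
  pose Pc' := [set d | exists2 q, P q & ale (ameet q c) d].
  have PPc' : P `<=` Pc' by move=> d Pd; exists d => //; apply: ale_meetl.
  have GPc' : G `|` Pc' = Pc'.
    by apply/setUidPr => d Gd; apply: PPc'; left.
  apply: (Xmax Pc'); first split.
  - by move=> d Xd; apply: PPc'; right.
  - move=> sub; apply: Pc; right; apply: sub.
    by exists (atop A); [case: filP|apply: ale_meetr].
  - rewrite /good GPc'; split.
    + apply: filterP.
      * by apply: PPc'; case: filP.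
      * move=> a b ab [q Pq qa]; exists q => //; exact: ale_trans qa ab.
      * move=> a b [q Pq qa] [r Pr rb]; exists (ameet q r).
          by apply/(filP.2 q r).
        apply: ale_meet; [apply: ale_trans qa|apply: ale_trans rb];
        apply: ale_meet; try exact: ale_meetr;
        apply: ale_trans (ale_meetl _ _) _; [exact: ale_meetl|exact: ale_meetr].
    + move=> a [q Pq qa] Ja; apply: noq; exists q => //.
      exact: ideal_le idJ qa Ja.
exists P; split=> //; last by move=> a; left.
split=> // [P0|a b]; first by apply: (PJ _ P0); case: idJ.
split=> [Pab|]; last first.
  by case; apply: filter_le filP _; [apply: ale_joinl|apply: ale_joinr].
apply: contrapT => /not_orP[/ext[q Pq Jq] /ext[r Pr Jr]].
(* This element lies in [P] and, by distributivity, in [J]. *)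
apply: (PJ (ameet (ajoin a b) (ameet q r))).
  by apply/(filP.2 _ _); split=> //; apply/(filP.2 q r).
rewrite (meet_joinl bdlA); apply/(idJ.2 _ _); split.
- apply: ideal_le idJ _ Jq; apply: ale_meet; last exact: ale_meetl.
  exact: ale_trans (ale_meetr _ _) (ale_meetl _ _).
- apply: ideal_le idJ _ Jr; apply: ale_meet; last exact: ale_meetl.
  exact: ale_trans (ale_meetr _ _) (ale_meetr _ _).
Qed.

End Lattice.

(** * Homomorphisms from a Kleene algebra to [K3] *)

Definition hom_of (A : algebra) (P : set A) (a : A) : K3 :=
  if `[< P a >] then Some true else
  if `[< P (aneg a) >] then Some false else None.

Section Kleene.
Variables (A : algebra) (kleA : kleene_algebra A).
Let bdlA := kleene_lattice kleA.

Lemma neg_join (a b : A) : aneg (ajoin a b) = ameet (aneg a) (aneg b).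
Proof. by rewrite -[RHS](negK kleA) (neg_meet kleA) !(negK kleA). Qed.

Lemma neg_top : aneg (atop A) = abot A.
Proof.
have := neg_meet kleA (atop A) (aneg (abot A)).
by rewrite (meet1a bdlA) (negK kleA) (joinC bdlA) (join0a bdlA).
Qed.

Lemma neg_bot : aneg (abot A) = atop A.
Proof. by rewrite -neg_top (negK kleA). Qed.

Lemma ale_neg (a b : A) : ale a b -> ale (aneg b) (aneg a).
Proof.
rewrite {1}/ale => <-.
by rewrite (neg_meet kleA); apply: (ale_joinr bdlA).
Qed.

Lemma hom_ofP (P : set A) :
  prime_filter P -> (forall a, P a -> ~ P (aneg a)) -> hom (hom_of P).
Proof.
move=> [[P1 PM] P0 PJ] PN.
have asbM a b : `[< P (ameet a b) >] = `[< P a >] && `[< P b >].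
  by rewrite -asbool_and; apply/asbool_equiv_eq.
have asbJ a b : `[< P (ajoin a b) >] = `[< P a >] || `[< P b >].
  by rewrite -asbool_or; apply/asbool_equiv_eq.
have asbN a : `[< P a >] && `[< P (aneg a) >] = false.
  by apply/negP => /andP[/asboolP Pa /asboolP]; apply: PN.
have asb0 : `[< P (abot A) >] = false by apply/asboolP.
have asb1 : `[< P (atop A) >] = true by apply/asboolP.
split; rewrite /hom_of.
- by rewrite asb0 neg_bot asb1.
- by rewrite asb1.
- move=> a; rewrite (negK kleA); have := asbN a.
  by do 2!case: `[< _ >].
- move=> a b; rewrite (neg_meet kleA) asbM asbJ.
  by have := asbN a; have := asbN b; do 4!case: `[< _ >].
- move=> a b; rewrite neg_join asbM asbJ.
  by have := asbN a; have := asbN b; do 4!case: `[< _ >].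
Qed.

Lemma hom_of_true (P : set A) (a : A) : hom_of P a = Some true <-> P a.
Proof.
rewrite /hom_of; case: asboolP => [Pa|nPa]; first by split.
by split=> //; case: ifP.
Qed.

(** The value [Some false] at [a] is [Some true] at [aneg a], so comparing true elements
    suffices. *)
Lemma hom_refines (f g : A -> K3) : hom f -> hom g ->
  (forall a, f a = Some true -> g a = Some true) -> forall a, refines (f a) (g a).
Proof.
move=> homf homg fg a; rewrite /refines.
case Efa: (f a) => [[]|] //; first by rewrite (fg a).
have : g (aneg a) = Some true by apply: fg; rewrite (hom_neg homf) Efa.
by rewrite (hom_neg homg); case: (g a) => [[]|].
Qed.

(** This is the involution on prime filters of a De Morgan algebra; it exchanges the meet and join
    conditions. *)
Lemma prime_filter_neg (P : set A) :
  prime_filter P -> prime_filter [set a | ~ P (aneg a)].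
Proof.
move=> [[P1 PM] P0 PJ]; split=> /=; last 1 first.
- by move=> a b; rewrite neg_join -not_andE; apply: not_iff_compat; apply: PM.
- split=> [|a b] /=; first by rewrite neg_top.
  by rewrite (neg_meet kleA) -not_orE; apply: not_iff_compat; apply: PJ.
- by rewrite neg_bot => /(_ P1).
Qed.

(** Some prime filter contains [a] but not [b]; it or its image under the involution is free of
    complementary pairs and defines a homomorphism. *)
Lemma hom_separates (a b : A) :
  ~ ale a b -> exists2 f : A -> K3, hom f & f a <> f b.
Proof.
move=> ab.
have filG : lattice_filter [set c | ale a c].
  apply: (filterP bdlA) => /=; first exact: (ale_top bdlA).
  - by move=> c d cd ac; apply: (ale_trans bdlA) cd.
  - by move=> c d; apply: (ale_meet bdlA).
have idJ : lattice_ideal [set c | ale c b].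
  split=> [|c d] /=; first exact: (ale_bot bdlA).
  split=> [cdb|[cb db]]; last exact: (ale_join bdlA).
  split; apply: (ale_trans bdlA) cdb;
    [exact: (ale_joinl bdlA)|exact: (ale_joinr bdlA)].
have [|P [pfP GP PJ]] := prime_filter_exists bdlA filG idJ.
  by move=> c ac cb; apply: ab; apply: (ale_trans bdlA) cb.
have Pa : P a by apply: GP; apply: (ale_refl bdlA).
have Pb : ~ P b by move=> /PJ; apply; apply: (ale_refl bdlA).
have [PN|/existsNP[c /not_implyP[Pc /contrapT PNc]]] :=
    pselect (forall c, P c -> ~ P (aneg c)).
  exists (hom_of P); first exact: hom_ofP.
  by move/hom_of_true: Pa => -> /esym/hom_of_true.
(* Dichotomy by the Kleene law: [P] either contains no pair [c], [aneg c]
   or meets every such pair. *)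
have PT d : P d \/ P (aneg d).
  apply/(prime_filter_join pfP d (aneg d)).
  have filP := prime_filter_filter pfP.
  apply: (filter_le filP (kleene_le kleA c d)).
  by apply/(filP.2 c (aneg c)).
exists (hom_of [set d | ~ P (aneg d)]).
  apply: hom_ofP; first exact: prime_filter_neg.
  by move=> d /= nPd; rewrite (negK kleA); apply; case: (PT d).
have PNb : P (aneg b) by case: (PT b).
rewrite /hom_of /= !(negK kleA).
case: (asboolP (~ P a)) => [/(_ Pa) //|_].
case: (asboolP (~ P (aneg b))) => [/(_ PNb) //|_].
by case: (asboolP (~ P b)) => // _; case: ifP.
Qed.

Lemma hom_separates_neq (a b : A) :
  a <> b -> exists2 f : A -> K3, hom f & f a <> f b.
Proof.
move=> ab; have [/hom_separates //|/contrapT leab] := pselect (~ ale a b).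
have [//|f homf fab] := @hom_separates b a.
  by move=> leba; apply: ab; apply: (ale_anti bdlA).
by exists f => // /esym.
Qed.

(** For two such elements, the Kleene law gives ¬c = c ∧ ¬c ≤ d ∨ ¬d = d. Closure under meets is
    needed to build a filter in [hom_classical]. *)
Lemma ale_neg_meet (a b : A) : ale (aneg a) a -> ale (aneg b) b ->
  ale (aneg (ameet a b)) (ameet a b).
Proof.
have le_of (c d : A) : ale (aneg c) c -> ale (aneg d) d -> ale (aneg c) d.
  move=> cc dd; have := kleene_le kleA c d.
  rewrite (meetC bdlA c) cc => cd; apply: (ale_trans bdlA) cd _.
  by apply: (ale_join bdlA) => //; apply: (ale_refl bdlA).
move=> aa bb; rewrite (neg_meet kleA).
by apply: (ale_join bdlA); apply: (ale_meet bdlA) => //; apply: le_of.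
Qed.

(** A prime filter with exactly one of [a], [aneg a] for each [a] gives a classical homomorphism. It
    exists once the filter [G] of forced elements is consistent, which the third clause ensures. *)
Lemma hom_classical (f : A -> K3) : hom f ->
  (forall a b : A, ale (aneg a) a ->
    ale (ameet a (aneg b)) (ajoin (aneg a) b) -> ale (aneg b) b) ->
  exists g : A -> K3,
    [/\ hom g, forall a, refines (f a) (g a) & forall a, isSome (g a)].
Proof.
move=> homf cl.
(* Generated by the elements that [f] makes true and those above their own negation, among them
   every a ∨ ¬a. *)
pose G := [set d | exists e a, [/\ f e = Some true, ale (aneg a) a
  & ale (ameet e a) d]].
have filG : lattice_filter G.
  apply: (filterP bdlA).
  - exists (atop A), (atop A); split; first exact: (hom_top homf).
    + by rewrite neg_top; apply: (ale_bot bdlA).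
    + exact: (ale_top bdlA).
  - move=> c d cd [e [a [fe aa eac]]]; exists e, a; split=> //.
    exact: (ale_trans bdlA) eac cd.
  - move=> c d [e [a [fe aa eac]]] [e' [a' [fe' aa' eac']]].
    exists (ameet e e'), (ameet a a'); split.
    + by rewrite (hom_meet homf) fe fe'.
    + exact: ale_neg_meet.
    + have -> : ameet (ameet e e') (ameet a a')
              = ameet (ameet e a) (ameet e' a').
        rewrite -!(meetA bdlA); congr ameet.
        by rewrite !(meetA bdlA) (meetC bdlA e').
      apply: (ale_meet bdlA).
      * exact: (ale_trans bdlA) (ale_meetl bdlA _ _) eac.
      * exact: (ale_trans bdlA) (ale_meetr bdlA _ _) eac'.
(* Avoiding this ideal keeps d ∧ ¬d out of the prime filter, since its negation is in [G]. *)
have idJ : lattice_ideal [set d | G (aneg d)].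
  split=> [|a b] /=; first by rewrite neg_bot; case: filG.
  by rewrite neg_join; apply: (filG.2 (aneg a) (aneg b)).
have fG a : f a = Some true -> G a.
  move=> fa; exists a, (atop A); split=> //.
  - by rewrite neg_top; apply: (ale_bot bdlA).
  - exact: (ale_meetl bdlA).
have GT a : G (ajoin a (aneg a)).
  exists (atop A), (ajoin a (aneg a)); split; first exact: (hom_top homf).
  - rewrite neg_join (negK kleA) (meetC bdlA).
    by apply: (ale_trans bdlA) (ale_meetl bdlA _ _) (ale_joinl bdlA _ _).
  - exact: (ale_meetr bdlA).
have [|P [pfP GP PJ]] := prime_filter_exists bdlA filG idJ.
  move=> d Gd /= GNd.
  have [e [a [fe aa ead]]] : G (ameet d (aneg d)) by apply/(filG.2 d (aneg d)).
  (* The clause is applied to [a] and [aneg e]: its second premise puts [ameet e a] below its own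
     negation, which holds via d ∧ ¬d. The conclusion e ≤ ¬e contradicts [f e = Some true]. *)
  suff : ale (aneg (aneg e)) (aneg e).
    rewrite (negK kleA) /ale => ee.
    by have := fe; rewrite -ee (hom_meet homf) (hom_neg homf) fe.
  apply: (cl a _ aa); rewrite (negK kleA) (meetC bdlA) -(neg_meet kleA).
  rewrite (meetC bdlA a).
  apply: (ale_trans bdlA ead); apply: (ale_trans bdlA) (ale_neg ead).
  rewrite (neg_meet kleA) (negK kleA).
  exact: (ale_trans bdlA) (ale_meetr bdlA _ _) (ale_joinl bdlA _ _).
have PT d : P d \/ P (aneg d).
  by apply/(prime_filter_join pfP d (aneg d)); apply: GP.
have PN d : P d -> ~ P (aneg d).
  move=> Pd PNd; apply: (PJ (ameet d (aneg d))).
    by apply/((prime_filter_filter pfP).2 d (aneg d)).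
  by rewrite /= (neg_meet kleA) (negK kleA) (joinC bdlA).
have homP : hom (hom_of P) by apply: hom_ofP.
exists (hom_of P); split=> //.
  by apply: hom_refines => // a fa; apply/hom_of_true; apply: GP; apply: fG.
move=> a; rewrite /hom_of; case: asboolP => // nPa.
by case: asboolP => // nPNa; case: (PT a).
Qed.

Lemma hom_least : atop A <> abot A ->
  (forall a b : A, ajoin a b = atop A -> a = atop A \/ b = atop A) ->
  exists2 f : A -> K3, hom f &
    forall g : A -> K3, hom g -> forall a, refines (f a) (g a).
Proof.
move=> top_bot join_top; pose P := [set a | a = atop A].
have homP : hom (hom_of P).
  apply: hom_ofP; last first.
    by move=> a /= ->; rewrite /P /= neg_top => /esym.
  split=> [||a b] /=; last 2 first.
  - by move=> /esym.
  - split; first exact: join_top.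
    case=> ->; first by apply: (ale_anti bdlA);
      [apply: (ale_top bdlA)|apply: (ale_joinl bdlA)].
    by apply: (ale_anti bdlA);
      [apply: (ale_top bdlA)|apply: (ale_joinr bdlA)].
  apply: (filterP bdlA) => //= [a b + a1|a b -> ->].
  - by rewrite a1 /ale (meet1a bdlA).
  - exact: (meet1a bdlA).
exists (hom_of P) => // g homg; apply: hom_refines => // a /hom_of_true ->.
exact: (hom_top homg).
Qed.

End Kleene.

(** * Identities of [K3], universal closure and the free algebra *)

Local Ltac K3_cases :=
  let p := fresh in
  move=> p; rewrite /holds /=; by case: (p 0) (p 1) (p 2) => [[]|] [[]|] [[]|].

(** The axioms are identities in at most three variables, each checked at the 27 triples of values
    in [K3]. *)
Lemma kleene_of_K3_identities (A : algebra) :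
  (forall s t, (forall p : nat -> K3, holds p (s, t)) ->
    forall v : nat -> A, holds v (s, t)) ->
  kleene_algebra A.
Proof.
move=> K3A.
pose env (a b c : A) n := nth a [:: a; b; c] n.
pose x := Var 0; pose y := Var 1; pose z := Var 2.
split; first split.
- move=> a b c;
  apply: (K3A (Meet x (Meet y z)) (Meet (Meet x y) z) _ (env a b c)); K3_cases.
- move=> a b;
  apply: (K3A (Meet x y) (Meet y x) _ (env a b b)); K3_cases.
- move=> a b c;
  apply: (K3A (Join x (Join y z)) (Join (Join x y) z) _ (env a b c)); K3_cases.
- move=> a b;
  apply: (K3A (Join x y) (Join y x) _ (env a b b)); K3_cases.
- move=> a b;
  apply: (K3A (Meet x (Join x y)) x _ (env a b b)); K3_cases.
- move=> a b;
  apply: (K3A (Join x (Meet x y)) x _ (env a b b)); K3_cases.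
- move=> a b c.
  apply: (K3A (Meet (Join x y) z) (Join (Meet x z) (Meet y z)) _ (env a b c)); K3_cases.
- move=> a; apply: (K3A (Join Bot x) x _ (env a a a)); K3_cases.
- move=> a; apply: (K3A (Meet Top x) x _ (env a a a)); K3_cases.
- move=> a; apply: (K3A (Neg (Neg x)) x _ (env a a a)); K3_cases.
- move=> a b;
  apply: (K3A (Neg (Meet x y)) (Join (Neg x) (Neg y)) _ (env a b b)); K3_cases.
- move=> a b; pose s := Meet x (Neg x).
  apply: (K3A (Meet s (Join y (Neg y))) s _ (env a b b)); K3_cases.
Qed.

Lemma univ_closureP (K : algebra_class) (A : algebra) :
  univ_closure K A <->
  forall c, (forall B, K B -> satisfies B c) -> satisfies A c.
Proof.
split=> [UA c Kc|KA U [L UL] KU].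
  pose U B := forall c, (forall C, K C -> satisfies C c) -> satisfies B c.
  have /UA UU : universal_class U.
    by exists [set c | forall B, K B -> satisfies B c].
  by apply: UU c Kc => B KB c; apply.
by apply/UL => c Lc; apply: KA => B /KU /UL; apply.
Qed.

Section FreeAlgebra.
Local Open Scope quotient_scope.

Lemma eval_repr_pi (Q : algebra_class) (A : algebra) (p : nat -> A) (t : term) :
  Q A -> eval p (repr (\pi_(free_carrier Q) t)) = eval p t.
Proof.
move=> QA.
have /eqmodP/asboolP : \pi_(free_carrier Q) (repr (\pi_(free_carrier Q) t))
  = \pi_(free_carrier Q) t by rewrite reprK.
exact.
Qed.

Lemma eval_repr_eval (Q : algebra_class) (A : algebra) (p : nat -> A)
    (v : nat -> free_algebra Q) (t : term) :
  Q A -> eval p (repr (eval v t)) = eval (fun n => eval p (repr (v n))) t.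
Proof.
move=> QA.
by elim: t => [n||| s IHs|s IHs u IHu|s IHs u IHu] //=;
  rewrite eval_repr_pi //= ?IHs ?IHu.
Qed.

Local Notation F := (free_algebra kleene_algebra).

(** An identity failing in a Kleene algebra fails in [K3] after composition with a separating
    homomorphism. *)
Lemma free_kleene_eq (a b : F) :
  (forall p : nat -> K3, eval p (repr a) = eval p (repr b)) -> a = b.
Proof.
move=> ab; rewrite -[a]reprK -[b]reprK; apply/eqmodP/asboolP => A kleA v.
apply: contrapT => /(hom_separates_neq kleA)[f homf].
by rewrite !hom_eval.
Qed.

Lemma holds_free_kleene (v : nat -> F) (e : identity) :
  holds v e <-> forall p : nat -> K3, holds (fun n => eval p (repr (v n))) e.
Proof.
rewrite /holds; split=> [ve p|ve].
  by rewrite -!eval_repr_eval ?ve; [|exact: K3_kleene..].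
by apply: free_kleene_eq => p; rewrite !eval_repr_eval; [|exact: K3_kleene..].
Qed.

End FreeAlgebra.

(** * Decision lists of homomorphisms and transfer of refutations *)

Section Embedding.
Variables (A : algebra) (bot_hom : A -> K3).

Definition classical_extension (l : (A -> K3) * (A -> K3)) : Prop :=
  [/\ hom l.1, hom l.2, forall a, refines (l.1 a) (l.2 a)
    & forall a, isSome (l.2 a)].

Hypothesis hom_bot_hom : hom bot_hom.
Hypothesis bot_hom_least :
  forall g : A -> K3, hom g -> forall a, refines (bot_hom a) (g a).

Definition leaf_hom (p : nat -> K3) (l : (A -> K3) * (A -> K3)) (a : A) : K3 :=
  if p 0 is None then l.1 a else l.2 a.

(* A decision list: the first variable among [Var k], [Var k.+1], ... that is
   not [Some false] selects a leaf if it is [Some true], and [bot_hom] if it is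
   [None]; [Var 0] then chooses between the two components of the leaf. *)
Fixpoint decide (p : nat -> K3) k l0 (ls : seq ((A -> K3) * (A -> K3))) : A -> K3 :=
  match ls with
  | [::] => leaf_hom p l0
  | l :: ls' =>
      match p k with
      | Some true => leaf_hom p l
      | Some false => decide p k.+1 l0 ls'
      | None => bot_hom
      end
  end.

(** Where [l.1] is undecided, the join of [Var 0] with its negation ranges over [None] and
    [Some true], the meet over [None] and [Some false], with [None] exactly when [Var 0] is
    [None]. *)
Definition leaf_term (l : (A -> K3) * (A -> K3)) (a : A) : term :=
  match l.1 a, l.2 a with
  | Some true, _ => Top
  | Some false, _ => Bot
  | None, Some true => Join (Var 0) (Neg (Var 0))
  | None, _ => Meet (Var 0) (Neg (Var 0))
  end.

(** A value decided by the least homomorphism is common to all. Otherwise the last joinand vanishes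
    when [Var k] is classical, and keeps the value at [None] when [Var k] is [None]. *)
Fixpoint decide_term k l0 (ls : seq ((A -> K3) * (A -> K3))) (a : A) : term :=
  match ls with
  | [::] => leaf_term l0 a
  | l :: ls' =>
      match bot_hom a with
      | Some true => Top
      | Some false => Bot
      | None => Join (Join (Meet (Var k) (leaf_term l a))
                           (Meet (Neg (Var k)) (decide_term k.+1 l0 ls' a)))
                     (Meet (Var k) (Neg (Var k)))
      end
  end.

Lemma eval_leaf_term (p : nat -> K3) l a : classical_extension l ->
  eval p (leaf_term l a) = leaf_hom p l a.
Proof.
case=> _ _ /(_ a) + /(_ a); rewrite /leaf_term /leaf_hom.
by case: (l.1 a) (l.2 a) => [[]|] [[]|] //= _ _; case: (p 0) => [[]|].
Qed.

Lemma hom_leaf (p : nat -> K3) l : classical_extension l -> hom (leaf_hom p l).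
Proof. by case=> ? ? _ _; rewrite /leaf_hom; case: (p 0). Qed.

(** Indices past the end of [ls] let the hypothesis cover [l0]. *)
Lemma hom_decide (p : nat -> K3) k l0 ls :
  (forall i, classical_extension (nth l0 ls i)) -> hom (decide p k l0 ls).
Proof.
elim: ls k => [|l ls IH] k ext /=; first exact: hom_leaf (ext 0).
case: (p k) => [[]|] //; first exact: hom_leaf (ext 0).
by apply: IH => i; apply: (ext i.+1).
Qed.

Lemma eval_decide_term (p : nat -> K3) k l0 ls a :
  (forall i, classical_extension (nth l0 ls i)) ->
  eval p (decide_term k l0 ls a) = decide p k l0 ls a.
Proof.
elim: ls k => [|l ls IH] k ext; first exact: eval_leaf_term (ext 0).
have := bot_hom_least (hom_decide p k ext) a.
rewrite [decide_term _ _ _ _]/=; case Ea: (bot_hom a) => [b|] ref.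
  by rewrite (refines_some ref erefl); case: (b).
rewrite /= (eval_leaf_term _ _ (ext 0)) IH => [|i]; last exact: (ext i.+1).
case: (p k) => [[]|]; rewrite ?Ea /=;
  case: (leaf_hom p l a) => [[]|] //=; by case: (decide _ _ _ _ a) => [[]|].
Qed.

(** Only [Var m] is true, so it selects the entry at position [m - k], or the search ends at [l0];
    [Var 0] being [None] picks the first component. With [k] positive, the search itself never tests
    [Var 0]. *)
Lemma decide_nth k m l0 ls : 0 < k <= m ->
  decide (fun n => if n == 0 then None else Some (n == m)) k l0 ls
  = (nth l0 ls (m - k)).1.
Proof.
elim: ls k => [|l ls IH] k /andP[k0 km] /=; first by rewrite nth_nil.
rewrite (gtn_eqF k0); have [->|neq] := eqVneq k m; first by rewrite subnn.
have ltkm : k < m by rewrite ltn_neqAle neq.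
by rewrite IH // -[m - k]subnSK.
Qed.

End Embedding.

(** Under the transferred assignment [w], each assignment into [K3] acts as a homomorphism on [A],
    so premises stay true; every failing conclusion is separated by one of these homomorphisms. *)
Lemma satisfies_of_free_kleene (A : algebra) (c : clause) :
  kleene_algebra A -> atop A <> abot A ->
  (forall a b : A, ajoin a b = atop A -> a = atop A \/ b = atop A) ->
  (forall a b : A, ale (aneg a) a ->
    ale (ameet a (aneg b)) (ajoin (aneg a) b) -> ale (aneg b) b) ->
  satisfies (free_algebra kleene_algebra) c -> satisfies A c.
Proof.
move=> kleA top_bot join_top cl Fc v vS.
have [bot_hom hbot bot_least] := hom_least kleA top_bot join_top.
have sep (e : identity) : exists l : (A -> K3) * (A -> K3),
    classical_extension l /\
    (~ holds v e -> l.1 (eval v e.1) <> l.1 (eval v e.2)).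
  have [f homf fe] : exists2 f : A -> K3, hom f &
      ~ holds v e -> f (eval v e.1) <> f (eval v e.2).
    have [ve|nve] := pselect (holds v e); first by exists bot_hom.
    by have [f homf fe] := hom_separates_neq kleA nve; exists f.
  have [g [homg fg gS]] := hom_classical kleA homf cl.
  by exists (f, g).
have {sep}[g gP] := choice sep.
(* The trivial identity supplies a final leaf even when [c.2] is empty. *)
pose l0 := g (Top, Top); pose ls := map g c.2.
have ext i : classical_extension (nth l0 ls i).
  have [ltis|leis] := ltnP i (size c.2); last first.
    by rewrite nth_default ?size_map //; case: (gP (Top, Top)).
  by rewrite (nth_map (Top, Top)) //; case: (gP (nth (Top, Top) c.2 i)).
(* Tests start at [Var 1], as [Var 0] is reserved for the leaves. *)
pose w n : free_algebra kleene_algebra :=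
  (\pi_(free_carrier kleene_algebra) (decide_term bot_hom 1 l0 ls (v n)))%qT.
have wP p t : eval (fun n => eval p (repr (w n))) t
    = decide bot_hom p 1 l0 ls (eval v t).
  rewrite (hom_eval _ _ (hom_decide hbot p 1 ext)).
  congr (eval _ t); apply: funext => n /=.
  by rewrite eval_repr_pi ?eval_decide_term //; apply: K3_kleene.
have [e Se|e De we] := Fc w.
  by apply/holds_free_kleene => p; rewrite /holds !wP vS.
exists e => //; apply: contrapT => nve; apply: (gP e).2 nve _.
(* [Var 1] tests the head of [ls], hence the successor. *)
pose m := (index e c.2).+1.
have := (holds_free_kleene w e).1 we
  (fun n => if n == 0 then None else Some (n == m)).
rewrite /holds !wP decide_nth // subSS subn0.
by rewrite (nth_map (Top, Top)) ?index_mem // nth_index.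
Qed.

(** * The three clauses as conditions on an algebra *)

Lemma nontrivial_clauseP (A : algebra) :
  satisfies A ([fset Top ≈ Bot] ⇒ fset0) <-> atop A <> abot A.
Proof.
split=> [cA top_bot|top_bot v]; last first.
  by move=> /(_ (Top, Bot)); rewrite /= inE eqxx => /(_ erefl).
have [e /=|e /=] := cA (fun=> atop A); last by rewrite inE.
by rewrite inE => /eqP ->.
Qed.

Lemma join_top_clauseP (A : algebra) (x := Var 0) (y := Var 1) :
  satisfies A ([fset Join x y ≈ Top] ⇒ [fset x ≈ Top; y ≈ Top]) <->
  (forall a b : A, ajoin a b = atop A -> a = atop A \/ b = atop A).
Proof.
split=> [cA a b ab|cA v vS].
  have [e /=|e /=] := cA (nth a [:: a; b]).
    by rewrite inE => /eqP ->.
  by rewrite !inE => /orP[] /eqP -> /=; [left|right].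
have /cA[v0|v1] : ajoin (v 0) (v 1) = atop A.
  by apply: (vS (Join x y, Top)); rewrite inE.
- by exists (x, Top); rewrite // !inE eqxx.
- by exists (y, Top); rewrite // !inE eqxx orbT.
Qed.

Lemma neg_le_clauseP (A : algebra) (x := Var 0) (y := Var 1) :
  satisfies A
    ([fset Neg x ≼ x; Meet x (Neg y) ≼ Join (Neg x) y] ⇒ [fset Neg y ≼ y]) <->
  (forall a b : A, ale (aneg a) a ->
    ale (ameet a (aneg b)) (ajoin (aneg a) b) -> ale (aneg b) b).
Proof.
split=> [cA a b aa ab|cA v vS].
  have [e /=|e /=] := cA (nth a [:: a; b]).
    by rewrite !inE => /orP[] /eqP ->.
  by rewrite inE => /eqP ->.
exists (Meet (Neg y) y, Neg y); first by rewrite inE.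
apply: (cA (v 0) (v 1)).
- by apply: (vS (Meet (Neg x) x, Neg x)); rewrite !inE eqxx.
- apply: (vS (Meet (Meet x (Neg y)) (Join (Neg x) y), Meet x (Neg y))).
  by rewrite !inE eqxx orbT.
Qed.

(** * The three clauses in the free Kleene algebra, and the basis theorem *)

Section FreeKleene.
Local Notation F := (free_algebra kleene_algebra).

Lemma free_kleene_nontrivial : atop F <> abot F.
Proof.
move=> /(congr1 (fun a : F => eval (fun=> None : K3) (repr a))).
by rewrite !eval_repr_pi //; apply: K3_kleene.
Qed.

(* A term with value [Some true] at the constant assignment [None], which every
   assignment refines, has that value everywhere. *)
Lemma free_kleene_join_top (a b : F) :
  ajoin a b = atop F -> a = atop F \/ b = atop F.
Proof.
have top_of (c : F) : eval (fun=> None : K3) (repr c) = Some true -> c = atop F.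
  move=> c1; apply: free_kleene_eq => p; rewrite eval_repr_pi; last exact: K3_kleene.
  by apply: refines_some c1; apply: eval_refines.
move=> /(congr1 (fun c : F => eval (fun=> None : K3) (repr c))).
rewrite !eval_repr_pi /=; [|exact: K3_kleene..].
case Ea: (eval _ (repr a)) => [[]|]; first by left; apply: top_of.
- by case Eb: (eval _ (repr b)) => [[]|] // _; right; apply: top_of.
- by case Eb: (eval _ (repr b)) => [[]|] // _; right; apply: top_of.
Qed.

(* If [b] took the value [Some false] at [p], then [a] would be [None] at [p];
   but both would be classical at a classical refinement of [p], where [b] is
   still [Some false] and so [a] cannot satisfy the two premises. *)
Lemma free_kleene_neg_le (a b : F) : ale (aneg a) a ->
  ale (ameet a (aneg b)) (ajoin (aneg a) b) -> ale (aneg b) b.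
Proof.
have evM p (c d : F) : eval p (repr (ameet c d))
    = ameet (eval p (repr c) : K3) (eval p (repr d)).
  by rewrite eval_repr_pi //; apply: K3_kleene.
have evJ p (c d : F) : eval p (repr (ajoin c d))
    = ajoin (eval p (repr c) : K3) (eval p (repr d)).
  by rewrite eval_repr_pi //; apply: K3_kleene.
have evN p (c : F) : eval p (repr (aneg c)) = aneg (eval p (repr c) : K3).
  by rewrite eval_repr_pi //; apply: K3_kleene.
move=> aa ab; apply: free_kleene_eq => p.
pose q n : K3 := if p n is None then Some true else p n.
have pq n : refines (p n) (q n) by rewrite /q; case: (p n) => [[]|].
have qS n : isSome (q n) by rewrite /q; case: (p n).
have aSq := eval_classical (repr a) qS.
have bpq := eval_refines (repr b) pq.
move: aa => /(congr1 (fun c : F => eval q (repr c))).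
move: ab => /(congr1 (fun c : F => eval q (repr c))).
rewrite !(evM, evJ, evN).
case: (eval p (repr b)) bpq => [[]|] // /refines_some/(_ erefl) ->.
by case: (eval q (repr a)) aSq => [[]|].
Qed.

End FreeKleene.

Theorem theorem35 :
  let x := Var 0 in
  let y := Var 1 in
  admissible_basis kleene_algebra
    [set [fset Top ≈ Bot] ⇒ fset0;
         [fset Join x y ≈ Top] ⇒ [fset x ≈ Top; y ≈ Top];
         [fset Neg x ≼ x; Meet x (Neg y) ≼ Join (Neg x) y] ⇒ [fset Neg y ≼ y]].
Proof.
move=> x y A; split=> [/univ_closureP FA|[kleA basisA]]; last first.
  apply/univ_closureP => c /(_ _ erefl); apply: satisfies_of_free_kleene => //.
  - by apply/nontrivial_clauseP; apply: basisA; left; left.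
  - by apply/join_top_clauseP; apply: basisA; left; right.
  - by apply/neg_le_clauseP; apply: basisA; right.
split.
  apply: kleene_of_K3_identities => s t st v.
  (* An identity of [K3], read as a clause without premises, holds in the free algebra and so passes
     to [A]. *)
  have [B ->|//|e /=] := FA (fset0, [fset (s, t)]) _ v.
    move=> w _; exists (s, t); first by rewrite inE.
    by apply/holds_free_kleene.
  by rewrite inE => /eqP ->.
move=> c basis_c; apply: FA => B ->.
case: basis_c => [[->|->]|->].
- by apply/nontrivial_clauseP; apply: free_kleene_nontrivial.
- by apply/join_top_clauseP; apply: free_kleene_join_top.
- by apply/neg_le_clauseP; apply: free_kleene_neg_le.
Qed.
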